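(* For every $k\ge 1$, the algebra $\mathcal{F}_0[k]^{*}$ is a polynomial algebra over $\mathbb{F}_2$ on the set $\{\,y_{k,i}\mid 1\le i\le k\,\}$.
   Context: Let $\mathcal{F}_0$ be the free graded associative unital $\mathbb{F}_2$-algebra generated by $\{Q^i\mid i\ge 0\}$ with $|Q^i|=i$. For a sequence $I=(i_k,\dots,i_1)$ of non-negative integers write $Q^I=Q^{i_k}\cdots Q^{i_1}$, with length $l(I)=k$ and degree $|I|=\sum_t i_t$. $\mathcal{F}_0$ is a Hopf algebra with coproduct the algebra map $\psi$ with $\psi(Q^i)=\sum_{t=0}^{i}Q^{i-t}\otimes Q^t$ and augmentation $\varepsilon(Q^0\cdots Q^0)=1$ on degree $0$ (and zero in positive degree). $\mathcal{F}_0[k]$ is the subcoalgebra of $\mathcal{F}_0$ spanned by $\{Q^I\mid l(I)=k\}$; it is finite dimensional in each degree. $\mathcal{F}_0[k]^{*}$ denotes its (graded) dual over $\mathbb{F}_2$, an algebra with product dual to $\psi$. For $1\le i\le k$ let $x_{k,i}=\underbrace{Q^0\cdots Q^0}_{k-i}\,\underbrace{Q^1Q^0\cdots Q^0}_{i}$, and let $y_{k,i}=(x_{k,i})^{*}$ be the element of $\mathcal{F}_0[k]^{*}$ dual to $x_{k,i}$ with respect to the monomial basis $\{Q^I\mid l(I)=k\}$. The identity element of $\mathcal{F}_0[k]^{*}$ is $y_{k,0}=((Q^0)^k)^{*}$. *)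

(* Defs.v *)
From HB Require Import structures.
From mathcomp Require Import all_boot all_algebra.
From mathcomp Require Import finmap.
From mathcomp Require Import boolp.
From mathcomp Require Import monalg.

Set Implicit Arguments.
Unset Strict Implicit.
Unset Printing Implicit Defensive.

Import GRing.Theory.
Local Open Scope ring_scope.

Section ProductMonomial.
Variables M N : monomType.

Definition pmul (x y : M * N) : M * N := (mmul x.1 y.1, mmul x.2 y.2).
Definition pone : M * N := (mone, mone).

Fact pmulA : associative pmul.
Proof. by move=> x y z; rewrite /pmul /= !mulmA. Qed.

Fact pmul1m : left_id pone pmul.
Proof. by case=> x y; rewrite /pmul /= !mul1m. Qed.

Fact pmulm1 : right_id pone pmul.
Proof. by case=> x y; rewrite /pmul /= !mulm1. Qed.

Fact pmul_eq1 x y : pmul x y = pone -> x = pone /\ y = pone.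
Proof.
case: x y => [x1 x2] [y1 y2]; rewrite /pmul /pone /=.
by case=> /unitm[-> ->] /unitm[-> ->].
Qed.

HB.instance Definition _ := Choice_isMonomialDef.Build (M * N)%type
  pmulA pmul1m pmulm1 pmul_eq1.

End ProductMonomial.

Section LinearExtension.
Variables (R : comNzRingType) (K : choiceType) (V : lmodType R) (h : K -> V).

Definition linext (x : {malg R[K]}) : V := \sum_(k <- msupp x) x@_k *: h k.

Lemma linextEw (d : {fset K}) x : (msupp x `<=` d)%fset ->
  linext x = \sum_(k <- d) x@_k *: h k.
Proof.
move=> le; rewrite [LHS](big_fset_incl _ le) => //= k kd /mcoeff_outdom ->.
by rewrite scale0r.
Qed.

Lemma linextU k : linext << k >> = h k.
Proof. by rewrite (linextEw msuppU_le) big_seq_fset1 mcoeffUU scale1r. Qed.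

Fact linext_is_linear : linear linext.
Proof.
move=> a x y; pose d := (msupp x `|` msupp y)%fset.
have dx : (msupp x `<=` d)%fset by exact: fsubsetUl.
have dy : (msupp y `<=` d)%fset by exact: fsubsetUr.
have dz : (msupp (a *: x + y)%R `<=` d)%fset.
  by apply: (fsubset_trans (msuppD_le _ _)); apply: fsetSU; exact: msuppZ_le.
rewrite (linextEw dx) (linextEw dy) (linextEw dz) scaler_sumr -big_split /=.
by apply: eq_bigr => k _; rewrite mcoeffD mcoeffZ scalerDl scalerA.
Qed.

HB.instance Definition _ :=
  GRing.isLinear.Build R {malg R[K]} V *:%R linext linext_is_linear.

End LinearExtension.

Section MonoidAlgebra.
Variables (R : comNzRingType) (K : monomType).

Lemma malgU_scale (a : R) (k : K) : << a *g k >> = a *: << k >> :> {malg R[K]}.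
Proof.
by apply/malgP => m; rewrite mcoeffZ !mcoeffU mulrnAr mulr1.
Qed.

Lemma malg_scalerAr (a : R) (x y : {malg R[K]}) : a *: (x * y) = x * (a *: y).
Proof.
apply/malgP => m.
rewrite mcoeffZ (mcoeffMlw (d1 := msupp x) (d2 := msupp y)) //.
rewrite (mcoeffMlw (d1 := msupp x) (d2 := msupp y)) ?msuppZ_le // mulr_sumr.
apply: eq_bigr => p _; rewrite mulr_sumr; apply: eq_bigr => q _.
by rewrite mcoeffZ mulrCA !mulrnAr.
Qed.

Lemma malgUM (u v : K) : << u >> * << v >> = << (mmul u v) >> :> {malg R[K]}.
Proof. by rewrite malgM_def fgmulUU mulr1. Qed.

Lemma malg_morph_mult (A : lalgType R) (f : {linear {malg R[K]} -> A}) :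
    (forall a (x y : A), a *: (x * y) = x * (a *: y)) ->
    (forall u v : K, f << (mmul u v) >> = f << u >> * f << v >>) ->
  {morph f : x y / x * y}.
Proof.
move=> Ar fM x y.
rewrite [x in LHS]monalgE [y in LHS]monalgE [x in RHS]monalgE [y in RHS]monalgE.
rewrite mulr_suml !linear_sum mulr_suml; apply: eq_bigr => u _.
rewrite !mulr_sumr linear_sum; apply: eq_bigr => v _.
rewrite !(malgU_scale x@_u) !(malgU_scale y@_v) -scalerAl -malg_scalerAr malgUM.
by rewrite !linearZ -scalerAl -Ar fM.
Qed.

End MonoidAlgebra.

(* The free associative algebra is the monoid algebra of the free monoid of
   words in the letters i : nat (the letter i standing for Q^i); the word
   (i_k, ..., i_1), written from left to right, is the basis element Q^I. *)
Notation word := {fmonom nat}.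
Notation F0 R := {malg R[word]}.

(* F0 (x) F0: the tensor product of monoid algebras is the monoid algebra of
   the product monoid, the basis element << (u, v) >> standing for u (x) v. *)
Notation F0F0 R := {malg R[(word * word)%type]}.

Definition wdeg (w : word) : nat := \sum_(i <- w) i.

Section Splittings.
Variable R : comNzRingType.

Lemma sum_triangle (n : nat) (F : nat -> nat -> nat -> R) :
  \sum_(t < n.+1) \sum_(s < (n - t).+1) F (n - t - s)%N s t =
  \sum_(t < n.+1) \sum_(s < t.+1) F (n - t)%N (t - s)%N s.
Proof.
transitivity (\sum_(0 <= t < n.+1) \sum_(t <= s < n.+1)
                F (n - s)%N (s - t)%N t).
  rewrite big_mkord; apply: eq_bigr => t _.
  have tn : (t <= n)%N by rewrite -ltnS.
  rewrite -[X in \sum_(X <= _ < _) _]add0n big_addn subSn // big_mkord.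
  by apply: eq_bigr => s _; rewrite addnK addnC subnDA.
under eq_bigr do rewrite (big_nat_widenl _ 0) //.
rewrite (exchange_big_dep_nat predT) //= big_mkord; apply: eq_bigr => t _.
rewrite -(big_mkord xpredT (fun s => F (n - t)%N (t - s)%N s)).
by rewrite [RHS](big_nat_widen _ _ n.+1).
Qed.

(* Sum of h u v over the componentwise splittings s = u + v, which is the
   value of h on the coproduct of Q^s. *)
Fixpoint conv (s : seq nat) (h : seq nat -> seq nat -> R) : R :=
  if s is i :: s' then
    \sum_(t < i.+1) conv s' (fun u v => h ((i - t)%N :: u) ((t : nat) :: v))
  else h [::] [::].

Lemma eq_conv s h h' :
  (forall u v, size u = size s -> size v = size s ->
     (sumn u + sumn v = sumn s)%N -> h u v = h' u v) ->
  conv s h = conv s h'.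
Proof.
elim: s h h' => [|i s IH] h h' hh' /=; first exact: hh'.
apply: eq_bigr => t _; apply: IH => u v su sv duv.
apply: hh' => /=; rewrite ?su ?sv // addnACA duv subnK //.
by rewrite -ltnS.
Qed.

Lemma conv0 s : conv s (fun _ _ => 0) = 0.
Proof. by elim: s => //= i s ->; rewrite big1. Qed.

Lemma convD s h h' : conv s (fun u v => h u v + h' u v) = conv s h + conv s h'.
Proof.
elim: s h h' => //= i s IH h h'.
by rewrite -big_split; apply: eq_bigr => t _; rewrite IH.
Qed.

Lemma convZ s a h : conv s (fun u v => a * h u v) = a * conv s h.
Proof.
elim: s h => //= i s IH h.
by rewrite mulr_sumr; apply: eq_bigr => t _; rewrite IH.
Qed.

Lemma conv_sum s n (h : 'I_n -> seq nat -> seq nat -> R) :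
  conv s (fun u v => \sum_i h i u v) = \sum_i conv s (h i).
Proof.
elim: s h => //= i s IH h.
by rewrite exchange_big; apply: eq_bigr => t _; rewrite IH.
Qed.

Lemma convC s h : conv s h = conv s (fun u v => h v u).
Proof.
elim: s h => //= i s IH h.
rewrite (reindex_inj rev_ord_inj); apply: eq_bigr => t _ /=.
by rewrite IH subSS subKn // -ltnS.
Qed.

Lemma convA s (h : seq nat -> seq nat -> seq nat -> R) :
  conv s (fun u v => conv u (fun a b => h a b v)) =
  conv s (fun u v => conv v (h u)).
Proof.
elim: s h => //= i s IH h.
rewrite [LHS](eq_bigr (fun t : 'I_i.+1 => \sum_(r < (i - t).+1)
  conv s (fun u v => conv v (fun b c =>
    h ((i - t - r)%N :: u) ((r : nat) :: b) ((t : nat) :: c))))); last first.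
  by move=> t _; rewrite conv_sum; apply: eq_bigr => r _; rewrite -IH.
rewrite (sum_triangle i (fun x y z => conv s (fun u v => conv v (fun b c =>
  h (x :: u) (y :: b) (z :: c))))).
by apply: eq_bigr => t _; rewrite conv_sum.
Qed.

Lemma conv1 s (g : seq nat -> R) :
  conv s (fun u v => (all (eq_op^~ 0%N) u)%:R * g v) = g s.
Proof.
elim: s g => [|i s IH] g /=; first by rewrite mul1r.
rewrite big_ord_recr big1 /= ?add0r => [|t _].
  by rewrite subnn eqxx /= (IH (fun v => g (i :: v))).
rewrite -[RHS](conv0 s); apply: eq_conv => u v _ _ _.
by rewrite subn_eq0 leqNgt ltn_ord /= mul0r.
Qed.

End Splittings.

Section Coalgebra.
(* Only R = 'F_2 is of interest; no construction depends on the field. *)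
Variable R : fieldType.

Local Notation F0 := (F0 R).
Local Notation F0F0 := (F0F0 R).

Definition Q (i : nat) : F0 := << fmu i >>.

Definition homog (n : nat) (x : F0) : Prop :=
  forall w, w \in msupp x -> wdeg w = n.

Definition psiQ (i : nat) : F0F0 :=
  \sum_(t < i.+1) << (fmu (i - t)%N, fmu (t : nat)) >>.

Definition psi : F0 -> F0F0 := linext (fun w : word => \prod_(i <- w) psiQ i).
HB.instance Definition _ := GRing.Linear.on psi.

Definition counit : F0 -> R :=
  linext (fun w : word => (all (eq_op^~ 0%N) w)%:R : R^o).

Fact counit_is_scalar : scalar counit.
Proof. by move=> a x y; rewrite /counit linext_is_linear. Qed.

HB.instance Definition _ :=
  GRing.isLinear.Build R F0 R *%R counit counit_is_scalar.

Lemma Q_word (s : seq nat) : \prod_(i <- s) Q i = << FMonom s >>.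
Proof.
elim: s => [|i s IH]; first by rewrite big_nil -fmoneE.
rewrite big_cons IH /Q malgUM; congr (<< _ >>).
by rewrite /mmul /= fmmulE fmuE.
Qed.

Lemma psi_word (w : word) : psi << w >> = \prod_(i <- w) psiQ i.
Proof. exact: linextU. Qed.

Lemma psi_Q i : psi (Q i) = psiQ i.
Proof. by rewrite /Q fmuE psi_word big_seq1. Qed.

Fact psi_is_multiplicative : multiplicative psi.
Proof.
split; last by rewrite -[1]/(<< @fmone _ >>) fmoneE psi_word big_nil.
apply: malg_morph_mult => [|u v]; first exact: malg_scalerAr.
rewrite -[LHS]/(psi << mmul u v >>) -[RHS]/(psi << u >> * psi << v >>).
by rewrite !psi_word (fmM u v) big_cat.
Qed.

HB.instance Definition _ :=
  GRing.isMultiplicative.Build F0 F0F0 psi psi_is_multiplicative.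

Lemma counit_word (w : word) : counit << w >> = (all (eq_op^~ 0%N) w)%:R.
Proof. by rewrite /counit linextU. Qed.

Fact counit_is_multiplicative : multiplicative counit.
Proof.
split; last by rewrite -[1]/(<< @fmone _ >>) fmoneE counit_word.
apply: (@malg_morph_mult _ _ R^o) => [a x y|u v]; first exact: scalerAr.
rewrite -[LHS]/(counit << mmul u v >>) -[RHS]/(counit << u >> * counit << v >>).
by rewrite !counit_word (fmM u v) all_cat -natrM mulnb.
Qed.

(* F_0[k], the span of the words of length k. *)
Definition lenk (k : nat) : {pred F0} :=
  [pred x : F0 | all (fun w : word => size w == k) (msupp x)].

Lemma lenkP k (x : F0) :
  reflect (forall w : word, w \in msupp x -> size w = k) (x \in lenk k).
Proof.
apply: (iffP allP) => H w /H; first by move/eqP.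
by move->; rewrite eqxx.
Qed.

Fact lenk_submod_closed k : submod_closed (lenk k).
Proof.
split=> [|a x y /lenkP Hx /lenkP Hy]; apply/lenkP => w; first by rewrite msupp0.
move/(fsubsetP (msuppD_le _ _)); rewrite in_fsetU => /orP[|/Hy//].
by move/(fsubsetP (msuppZ_le _ _)) => /Hx.
Qed.

HB.instance Definition _ k :=
  GRing.isSubmodClosed.Build R F0 (lenk k) (lenk_submod_closed k).

Record F0k (k : nat) := MkF0k { F0k_val :> F0; F0kP : F0k_val \in lenk k }.

HB.instance Definition _ k := [isSub for @F0k_val k].
HB.instance Definition _ k := [Choice of F0k k by <:].
HB.instance Definition _ k := [SubChoice_isSubLmodule of F0k k by <:].

Lemma lenk_word k (w : word) : (<< w >> \in lenk k) = (size w == k).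
Proof.
apply/lenkP/eqP => [H|H v].
  by apply: H; rewrite -mcoeff_neq0 mcoeffUU oner_neq0.
by move/(fsubsetP msuppU_le); rewrite in_fset1 => /eqP ->.
Qed.

(* Q^w as an element of F_0[k], with junk value 0 when l(w) <> k. *)
Definition mon (k : nat) (w : word) : F0k k := insubd 0 << w >>.

Lemma val_mon k w : val (mon k w) = if size w == k then << w >> else 0.
Proof. by rewrite val_insubd lenk_word; case: ifP. Qed.

Lemma F0kE k (x : F0k k) : x = \sum_(w <- msupp (val x)) (val x)@_w *: mon k w.
Proof.
have vZ a (y : F0k k) : val (a *: y) = a *: val y by rewrite linearZ.
apply: val_inj; rewrite linear_sum [LHS]monalgE big_seq [RHS]big_seq.
apply: eq_bigr => w /(lenkP _ _ (F0kP x)) wk.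
by rewrite -[RHS]/(val ((val x)@_w *: mon k w)) vZ val_mon wk eqxx -malgU_scale.
Qed.

Definition gbounded k (f : F0k k -> R) : Prop :=
  exists N, forall n (x : F0k k), (N <= n)%N -> homog n (val x) -> f x = 0.

(* The graded dual, i.e. the direct sum of the duals of the homogeneous
   components of F_0[k]: the linear forms on F_0[k] that vanish on all but
   finitely many of these components. *)
Record gdual (k : nat) := GDual {
  gfun :> F0k k -> R;
  gfunP : scalar gfun /\ gbounded gfun }.

HB.instance Definition _ k := gen_eqMixin (gdual k).
HB.instance Definition _ k := gen_choiceMixin (gdual k).
HB.instance Definition _ k (f : gdual k) :=
  GRing.isLinear.Build R (F0k k) R *%R (gfun f) (gfunP f).1.

Lemma linext_mulU (h : word * word -> R^o) m (z : F0F0) :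
  linext h (<< m >> * z) = linext (fun p => h (mmul m p)) z.
Proof.
rewrite [z in LHS]monalgE mulr_sumr linear_sum; apply: eq_bigr => p _.
rewrite (malgU_scale z@_p) -malg_scalerAr malgUM linearZ.
by congr (_ *: _); exact: linextU.
Qed.

Lemma linext_psi (h : word * word -> R^o) (w : word) :
  linext h (psi << w >>) = conv w (fun u v => h (FMonom u, FMonom v)).
Proof.
rewrite psi_word; case: w => s /=; elim: s h => [|i s IH] h.
  rewrite big_nil -[1]/(<< mone >>) linextU /=; congr h.
  by rewrite /mone /= /pone /mone /= fmoneE.
rewrite big_cons mulr_suml linear_sum; apply: eq_bigr => t _.
rewrite -[LHS]/(linext h _) linext_mulU IH; apply: eq_conv => u v _ _ _.
by rewrite /mmul /= /pmul /mmul /= !fmmulE !fmuE.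
Qed.

Lemma linext_psiE (h : word * word -> R^o) (x : F0) :
  linext h (psi x) =
  \sum_(w <- msupp x) x@_w *: conv w (fun u v => h (FMonom u, FMonom v)).
Proof.
rewrite -[LHS]/((linext h \o psi) x) {1}[x]monalgE linear_sum.
apply: eq_bigr => w _; rewrite malgU_scale linearZ.
by congr (_ *: _); exact: linext_psi.
Qed.

Lemma wdegE w : wdeg w = sumn w.
Proof. by rewrite /wdeg sumnE. Qed.

Lemma mcoeff_linext (K : choiceType) (x : {malg R[K]}) (m : K) :
  x@_m = linext (fun p => (p == m)%:R : R^o) x.
Proof.
rewrite {1}[x]monalgE raddf_sum; apply: eq_bigr => p _ /=.
by rewrite mcoeffU -[LHS]mulr_natr.
Qed.

Lemma psi_lenk k (x : F0) : x \in lenk k ->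
  forall p, p \in msupp (psi x) -> size p.1 = k /\ size p.2 = k.
Proof.
move=> /lenkP xk [p1 p2]; rewrite -mcoeff_neq0 mcoeff_linext linext_psiE => nz.
suff: (size p1 == k) && (size p2 == k) by case/andP => /eqP -> /eqP ->.
apply: contraNT nz => pk; apply/eqP; rewrite big_seq big1 // => w /xk wk.
rewrite (eq_conv (h' := fun _ _ => 0)) ?conv0 ?scaler0 // => u v su sv _.
by case: eqP => // -[E1 E2]; case/negP: pk; rewrite -E1 -E2 /= su sv wk eqxx.
Qed.

Section Dual.
Variable k : nat.
Implicit Types f g h : gdual k.

Lemma scalar_ext (f g : F0k k -> R) : scalar f -> scalar g ->
  (forall w : word, size w = k -> f (mon k w) = g (mon k w)) -> f =1 g.
Proof.
move=> fl gl fg x.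
pose F := GRing.isLinear.Build R (F0k k) R *%R f fl.
pose f' : {scalar F0k k} := HB.pack f F.
pose G := GRing.isLinear.Build R (F0k k) R *%R g gl.
pose g' : {scalar F0k k} := HB.pack g G.
rewrite -[f x]/(f' x) -[g x]/(g' x) [x]F0kE !linear_sum big_seq [RHS]big_seq.
apply: eq_bigr => w /(lenkP _ _ (F0kP x)) wk.
by rewrite !linearZ; congr (_ * _); exact: fg.
Qed.

Lemma gdual_ext f g :
  (forall w : word, size w = k -> f (mon k w) = g (mon k w)) -> f = g.
Proof.
move=> /(scalar_ext (gfunP f).1 (gfunP g).1) /funext.
case: f g => [f fP] [g gP] /= fg; rewrite fg in fP *.
by congr GDual; exact: Prop_irrelevance.
Qed.

Lemma homog_mon (w : word) : homog (wdeg w) (val (mon k w)).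
Proof.
move=> v; rewrite val_mon; case: ifP => _; last by rewrite msupp0.
by move/(fsubsetP msuppU_le); rewrite in_fset1 => /eqP ->.
Qed.

Lemma gbounded_mon (f : F0k k -> R) : scalar f ->
  (exists N, forall w : word, size w = k -> (N <= wdeg w)%N -> f (mon k w) = 0) ->
  gbounded f.
Proof.
move=> fl [N fN]; exists N => n x Nn xn.
pose F := GRing.isLinear.Build R (F0k k) R *%R f fl.
pose f' : {scalar F0k k} := HB.pack f F.
rewrite -[f x]/(f' x) [x]F0kE linear_sum big_seq big1 // => w wx.
have wk : size w = k by apply: (elimT (lenkP _ _) (F0kP x)).
have fw : f' (mon k w) = 0 by apply: fN; rewrite // (xn w wx).
by rewrite linearZ fw; exact: mulr0.
Qed.

Lemma gdual_bound f : exists N, forall w : word,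
  (N <= wdeg w)%N -> f (mon k w) = 0.
Proof.
by case: (gfunP f).2 => N fN; exists N => w /fN; apply; exact: homog_mon.
Qed.

Fact gzeroP : scalar (fun _ : F0k k => 0 : R) /\ gbounded (fun _ : F0k k => 0 : R).
Proof. by split=> [a x y|]; [rewrite mulr0 addr0 | exists 0%N]. Qed.
Definition gzero : gdual k := GDual gzeroP.

Fact goppP f : scalar (fun x => - f x) /\ gbounded (fun x => - f x).
Proof.
split=> [a x y|]; first by rewrite linearP /= opprD mulrN.
by case: (gfunP f).2 => N fN; exists N => n x Nn xn; rewrite (fN n) ?oppr0.
Qed.
Definition gopp f : gdual k := GDual (goppP f).

Fact gaddP f g : scalar (fun x => f x + g x) /\ gbounded (fun x => f x + g x).
Proof.
split=> [a x y|]; first by rewrite !linearP /= mulrDr addrACA.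
case: (gfunP f).2 (gfunP g).2 => [N fN] [M gM]; exists (maxn N M) => n x.
by rewrite geq_max => /andP[Nn Mn] xn; rewrite (fN n) ?(gM n) ?addr0.
Qed.
Definition gadd f g : gdual k := GDual (gaddP f g).

Fact gscaleP a f : scalar (fun x => a * f x) /\ gbounded (fun x => a * f x).
Proof.
split=> [b x y|]; first by rewrite linearP /= mulrDr mulrCA.
by case: (gfunP f).2 => N fN; exists N => n x Nn xn; rewrite (fN n) ?mulr0.
Qed.
Definition gscale a f : gdual k := GDual (gscaleP a f).

Fact goneP : scalar (fun x : F0k k => counit (val x)) /\
  gbounded (fun x : F0k k => counit (val x)).
Proof.
have lin : scalar (fun x : F0k k => counit (val x)).
  by move=> a x y; rewrite [X in counit X]linearP [LHS]counit_is_scalar.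
split=> //; apply: gbounded_mon => //; exists 1%N => w wk.
rewrite val_mon wk eqxx counit_word; case: allP => // w0.
rewrite /wdeg big_seq big1 // => i /w0; exact: eqP.
Qed.
Definition gone : gdual k := GDual goneP.

Definition gmul_fun f g (x : F0k k) : R :=
  linext (fun p => f (mon k p.1) * g (mon k p.2) : R^o) (psi (val x)).

Lemma gmul_mon f g (w : word) : size w = k -> gmul_fun f g (mon k w) =
  conv w (fun u v => f (mon k (FMonom u)) * g (mon k (FMonom v))).
Proof. by move=> wk; rewrite /gmul_fun val_mon wk eqxx linext_psi. Qed.

Fact gmulP f g : scalar (gmul_fun f g) /\ gbounded (gmul_fun f g).
Proof.
have lin : scalar (gmul_fun f g).
  move=> a x y.
  have psiE : psi (val (a *: x + y)) = a *: psi (val x) + psi (val y).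
    have -> : val (a *: x + y) = a *: val x + val y by rewrite linearP.
    exact: linext_is_linear.
  by rewrite /gmul_fun psiE; exact: (@linext_is_linear _ _ R^o).
split=> //; apply: gbounded_mon => //.
have [[N fN] [M gM]] := (gdual_bound f, gdual_bound g).
exists (N + M)%N => w wk; rewrite wdegE => wNM.
rewrite gmul_mon // -[RHS](conv0 R w); apply: eq_conv => u v _ _ uv.
have [Nu|Nu] := leqP N (sumn u); first by rewrite fN ?mul0r ?wdegE.
rewrite gM ?mulr0 // wdegE -(leq_add2l (sumn u)) /= uv.
by apply: leq_trans wNM; rewrite leq_add2r ltnW.
Qed.

(* The product dual to psi: (f g)(x) = (f (x) g)(psi x).  By psi_lenk, only
   pairs of words of length k occur in psi x. *)
Definition gmul f g : gdual k := GDual (gmulP f g).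

Fact gaddA : associative gadd.
Proof. by move=> f g h; apply: gdual_ext => w _; rewrite /= addrA. Qed.
Fact gaddC : commutative gadd.
Proof. by move=> f g; apply: gdual_ext => w _; rewrite /= addrC. Qed.
Fact gadd0 : left_id gzero gadd.
Proof. by move=> f; apply: gdual_ext => w _; rewrite /= add0r. Qed.
Fact gaddN : left_inverse gzero gopp gadd.
Proof. by move=> f; apply: gdual_ext => w _; rewrite /= addNr. Qed.

HB.instance Definition _ := GRing.isZmodule.Build (gdual k)
  gaddA gaddC gadd0 gaddN.

Fact gscaleA a b f : gscale a (gscale b f) = gscale (a * b) f.
Proof. by apply: gdual_ext => w _; rewrite /= mulrA. Qed.
Fact gscale1 : left_id 1 gscale.
Proof. by move=> f; apply: gdual_ext => w _; rewrite /= mul1r. Qed.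
Fact gscaleDr : right_distributive gscale +%R.
Proof. by move=> a f g; apply: gdual_ext => w _; rewrite /= mulrDr. Qed.
Fact gscaleDl f : {morph gscale^~ f : a b / a + b}.
Proof. by move=> a b; apply: gdual_ext => w _; rewrite /= mulrDl. Qed.

HB.instance Definition _ := GRing.Zmodule_isLmodule.Build R (gdual k)
  gscaleA gscale1 gscaleDr gscaleDl.

Fact gmulA : associative gmul.
Proof.
move=> f g h; apply: gdual_ext => w wk; rewrite /= !gmul_mon //=.
rewrite (eq_conv (h' := fun u v => conv v (fun b c => f (mon k (FMonom u)) *
  (g (mon k (FMonom b)) * h (mon k (FMonom c)))))); last first.
  by move=> u v _ vw _; rewrite convZ gmul_mon ?vw.
rewrite -convA; apply: eq_conv => u v uw _ _.
rewrite gmul_mon ?uw // mulrC -convZ; apply: eq_conv => a b _ _ _.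
by rewrite mulrA [RHS]mulrC.
Qed.

Fact gmulC : commutative gmul.
Proof.
move=> f g; apply: gdual_ext => w wk; rewrite /= !gmul_mon // convC.
by apply: eq_conv => u v _ _ _; rewrite mulrC.
Qed.

Fact gmul1 : left_id gone gmul.
Proof.
move=> f; apply: gdual_ext => w wk; rewrite /= gmul_mon //.
rewrite -[in RHS](fmK w) -(conv1 w (fun v => f (mon k (FMonom v)))).
by apply: eq_conv => u v uw _ _; rewrite /= val_mon /= uw wk eqxx counit_word.
Qed.

Fact gmulDl : left_distributive gmul +%R.
Proof.
move=> f g h; apply: gdual_ext => w wk; rewrite /= !gmul_mon // -convD.
by apply: eq_conv => u v _ _ _; rewrite /= mulrDl.
Qed.

Fact gone_neq0 : gone != 0.
Proof.
apply/eqP => /(congr1 (fun f : gdual k => f (mon k (FMonom (nseq k 0%N)))))/=.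
rewrite val_mon /= size_nseq eqxx counit_word /= all_nseq eqxx orbT.
by apply/eqP; exact: oner_neq0.
Qed.

HB.instance Definition _ := GRing.Zmodule_isComNzRing.Build (gdual k)
  gmulA gmulC gmul1 gmulDl gone_neq0.

Fact gscaleAl a f g : a *: (f * g) = (a *: f) * g.
Proof.
apply: gdual_ext => w wk; rewrite /= !gmul_mon // -convZ.
by apply: eq_conv => u v _ _ _; rewrite /= mulrA.
Qed.

HB.instance Definition _ := GRing.Lmodule_isLalgebra.Build R (gdual k) gscaleAl.
HB.instance Definition _ := GRing.Lalgebra_isComAlgebra.Build R (gdual k).

Fact dualmonP (w : word) : scalar (fun x : F0k k => (val x)@_w) /\
  gbounded (fun x : F0k k => (val x)@_w).
Proof.
split=> [a x y|].
  have -> : val (a *: x + y) = a *: val x + val y by rewrite linearP.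
  by rewrite mcoeffD mcoeffZ.
exists (wdeg w).+1 => n x wn xn; apply: mcoeff_outdom; apply/negP => /xn E.
by rewrite E ltnn in wn.
Qed.

(* The element of F_0[k]^* dual to Q^w in the monomial basis. *)
Definition dualmon (w : word) : gdual k := GDual (dualmonP w).

Lemma dualmonE (w v : word) : size v = k -> dualmon w (mon k v) = (v == w)%:R.
Proof. by move=> vk; rewrite /= val_mon vk eqxx mcoeffU. Qed.

End Dual.

Definition xword (k i : nat) : word :=
  FMonom (nseq (k - i) 0%N ++ 1%N :: nseq i.-1 0%N).

Definition xgen (k i : nat) : F0 := Q 0 ^+ (k - i) * (Q 1 * Q 0 ^+ i.-1).

Lemma xgenE k i : xgen k i = << xword k i >>.
Proof.
by rewrite /xword -Q_word big_cat big_cons /= !big_nseq /xgen !iter_mulr_1.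
Qed.

(* y_{k,i} is the element dual to x_{k,i} = Q^(xword k i), 1 <= i <= k. *)
Definition ygen (k i : nat) : gdual k := dualmon k (xword k i).

Lemma gdual1E k : 1 = dualmon k (FMonom (nseq k 0%N)) :> gdual k.
Proof.
apply: gdual_ext => w wk; rewrite dualmonE //= val_mon wk eqxx counit_word.
congr (nat_of_bool _)%:R; rewrite -val_eqE /= -wk.
by apply/all_pred1P/eqP.
Qed.

End Coalgebra.

(* Main.v *)
Require Import Defs.
From HB Require Import structures.
From mathcomp Require Import all_boot all_algebra.
From mathcomp Require boolp.
From mathcomp Require Import -(notations) monalg.
From mathcomp Require Import mpoly.

(** The coproduct splits every letter of a word separately, so it makes the
    words of length [k] into the [k]-fold tensor power of the coalgebra with
    basis [Q^0, Q^1, ...] and [Q^n |-> sum_t Q^(n-t) (x) Q^t].  The dual of one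
    factor is a polynomial algebra in one variable, and no divided powers
    appear, because every splitting of [Q^n] has coefficient 1.

    In terms of monomials: read a word of length [k] as an exponent vector.
    For words [a] and [b], the word [w] has exactly one splitting as [(a, b)]
    if it is the letterwise sum of [a] and [b], and none otherwise
    ([conv_delta]).  Hence the dual basis multiplies by adding exponents
    ([dualmon_expwordM]), and since [y_{k,i}] is dual to a unit vector
    ([expwordU]), the element dual to [w] is the monomial in the [y_{k,i}] with
    exponent vector [w] ([dualmon_expword_prod]).  The algebra map sending the
    variables to the [y_{k,i}] therefore sends the monomials to the dual basis:
    the value of the image of [p] on a word is a coefficient of [p]
    ([ygen_eval_coeff]), which gives injectivity.  A form in the graded dual
    vanishes on all words of large degree, so its values on words are the
    coefficients of a polynomial, which gives surjectivity
    ([ygen_eval_surj]).  All this holds over every field. *)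

Import GRing.Theory.
Local Open Scope ring_scope.

(** The two words are given as the values of [f] and [g] along one list of
    indices, so that their letterwise sum needs no zipping.  Each letter
    contributes one factor: [a] splits as [f x + g x] in at most one way. *)
Lemma conv_delta (R : comNzRingType) (T : Type) (f g : T -> nat)
    (r : seq T) (s : seq nat) : size s = size r ->
  conv s (fun u v => (u == map f r)%:R * (v == map g r)%:R) =
  (s == [seq (f x + g x)%N | x <- r])%:R :> R.
Proof.
elim: r s => [|x r IH] [|a s] //= => [_|[] /IH{}IH]; first by rewrite mulr1.
transitivity (\sum_(t < a.+1) ((a - t)%N == f x)%:R * (val t == g x)%:R *
    (s == [seq (f x + g x)%N | x <- r])%:R : R).
  apply: eq_bigr => t _; rewrite -IH -convZ; apply: eq_conv => u v _ _ _.
  by rewrite !eqseq_cons -!mulnb !natrM mulrACA.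
rewrite -mulr_suml eqseq_cons -mulnb natrM; congr (_ * _).
have [ga|ag] := leqP (g x) a; last first.
  rewrite big1 => [|t _].
    by rewrite (ltn_eqF (leq_trans ag (leq_addl _ _))).
  have /ltn_eqF -> : (val t < g x)%N by exact: leq_ltn_trans (leq_ord t) ag.
  by rewrite mulr0.
rewrite (bigD1 (Ordinal (ga : (g x < a.+1)%N))) //= big1 ?addr0.
  by rewrite eqxx mulr1 -(eqn_add2r (g x)) subnK.
by move=> t; rewrite -val_eqE /= => /negPf ->; rewrite mulr0.
Qed.

Lemma map_const (T U : Type) (c : U) (s : seq T) :
  [seq c | _ <- s] = nseq (size s) c.
Proof. by elim: s => //= _ s ->. Qed.

(** The first letter carries the exponent of the last variable, as
    [x_{k,i}] has its letter [Q^1] at the [i]-th place from the right. *)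
Definition expword (k : nat) (m : 'X_{1..k}) : word :=
  FMonom [seq m i | i <- rev (enum 'I_k)].

Lemma size_expword k (m : 'X_{1..k}) : size (expword k m) = k.
Proof. by rewrite size_map size_rev size_enum_ord. Qed.

Lemma expword_inj k : injective (expword k).
Proof.
move=> m1 m2 [] /eq_in_map E; apply/mnmP => i.
by apply: E; rewrite mem_rev mem_enum.
Qed.

Lemma expword_surj k (w : word) : size w = k -> exists m, w = expword k m.
Proof.
move=> wk; exists [multinom nth 0%N (rev w) i | i < k].
apply: val_inj => /=; rewrite (eq_map (mnmE _)) map_rev.
rewrite (map_comp (nth 0%N (rev w)) val) val_enum_ord -wk -size_rev.
by rewrite map_nth_iota0 // take_size revK.
Qed.

Lemma wdeg_expword k (m : 'X_{1..k}) : wdeg (expword k m) = mdeg m.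
Proof.
by rewrite /wdeg big_map (perm_big (enum 'I_k)) ?perm_rev //= big_enum mdegE.
Qed.

Lemma expwordU k (i : 'I_k) : expword k U_(i) = xword k i.+1.
Proof.
apply: val_inj => /=; rewrite map_rev -[RHS]revK rev_cat rev_cons !rev_nseq.
congr rev; rewrite (eq_map (mnm1E i)).
rewrite (map_comp (fun j => nat_of_bool (val i == j)) val) val_enum_ord cat_rcons.
have -> : iota 0 k = iota 0 i ++ val i :: iota i.+1 (k - i.+1).
  by rewrite -[in LHS](subnKC (ltn_ord i)) addSnnS iotaD.
rewrite map_cat /= eqxx; congr (_ ++ 1%N :: _).
  rewrite -[in RHS](size_iota 0 i) -map_const; apply/eq_in_map => j.
  by rewrite mem_iota => /andP[_ /gtn_eqF ->].
rewrite -[in RHS](size_iota i.+1 (k - i.+1)) -map_const.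
by apply/eq_in_map => j; rewrite mem_iota => /andP[/ltn_eqF ->].
Qed.

Section DualMonomials.
Variables (R : fieldType) (k : nat).

Local Notation delta m := (dualmon R k (expword k m)).

Lemma dualmon_expwordE m n : delta m (mon R k (expword k n)) = (n == m)%:R.
Proof. by rewrite dualmonE ?size_expword // (inj_eq (@expword_inj k)). Qed.

(** Evaluated on a word, the product runs over its splittings, and
    [conv_delta] counts the only one on which both factors are nonzero. *)
Lemma dualmon_expwordM m n : delta (m + n)%MM = delta m * delta n.
Proof.
apply: gdual_ext => w wk; have [p ->] := expword_surj k w wk.
rewrite [RHS]gmul_mon ?size_expword // dualmon_expwordE.
rewrite (eq_conv (h' := fun u v => (u == expword k m)%:R * (v == expword k n)%:R)).
  rewrite conv_delta ?size_map //; congr (nat_of_bool _)%:R.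
  rewrite -(inj_eq (@expword_inj k)) -val_eqE /=; congr (_ == _).
  by apply: eq_map => i; rewrite mnmDE.
by move=> u v; rewrite size_expword => uk vk _; rewrite !dualmonE.
Qed.

Lemma dualmon_expword0 : delta 0%MM = 1.
Proof.
rewrite gdual1E; congr dualmon; apply: val_inj => /=.
rewrite (eq_map mnm0E) map_const size_rev.
by rewrite size_enum_ord.
Qed.

(** The map from exponent vectors to dual basis elements is a monoid morphism,
    so it is determined by its values on the unit vectors. *)
Lemma dualmon_expword_prod m :
  delta m = \prod_(i < k) ygen R k i.+1 ^+ m i.
Proof.
rewrite {1}[m]multinomUE_id.
rewrite (big_morph (fun n => delta n) dualmon_expwordM dualmon_expword0).
apply: eq_bigr => i _; elim: (m i) => [|n IH].
  by rewrite mulm0n dualmon_expword0.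
by rewrite mulmS dualmon_expwordM IH exprS expwordU.
Qed.

Definition ygen_eval : {mpoly R[k]} -> gdual R k :=
  mmap (in_alg (gdual R k)) (fun i : 'I_k => ygen R k i.+1).

HB.instance Definition _ := GRing.RMorphism.on ygen_eval.

Fact ygen_eval_scalable : scalable ygen_eval.
Proof. by move=> a p; rewrite /ygen_eval mmapZ /= mulr_algl. Qed.

HB.instance Definition _ := GRing.isScalable.Build R {mpoly R[k]} (gdual R k)
  *:%R ygen_eval ygen_eval_scalable.

Lemma ygen_evalX (i : 'I_k) : ygen_eval 'X_i = ygen R k i.+1.
Proof. by rewrite /ygen_eval mmapX mmap1U. Qed.

(** Monomials go to dual basis elements, so evaluating on a word extracts the
    corresponding coefficient. *)
Lemma ygen_eval_coeff p m : ygen_eval p (mon R k (expword k m)) = p@_m.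
Proof.
pose ev (f : gdual R k) := f (mon R k (expword k m)).
rewrite [p in RHS]mpolyE raddf_sum /= /ygen_eval /mmap.
rewrite -[LHS]/(ev _) (big_morph ev (id1 := 0) (op1 := +%R)) //.
apply: eq_bigr => n _; rewrite mcoeffZ mcoeffX /ev mulr_algl /=.
by rewrite /mmap1 -dualmon_expword_prod dualmon_expwordE eq_sym.
Qed.

Lemma ygen_eval_inj : injective ygen_eval.
Proof. by move=> p q pq; apply/mpolyP => m; rewrite -!ygen_eval_coeff pq. Qed.

(** The gradedness of the dual enters here: the bound [N] on the degree makes
    the sum that defines the preimage of [f] finite. *)
Lemma ygen_eval_surj (f : gdual R k) : exists p, ygen_eval p = f.
Proof.
have [N fN] := gdual_bound f.
exists (\sum_(m : 'X_{1..k < N}) f (mon R k (expword k m)) *: 'X_[m]).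
apply: gdual_ext => w wk; have [m ->] := expword_surj k w wk.
rewrite ygen_eval_coeff; have [mN|Nm] := ltnP (mdeg m) N.
  by rewrite (mcoeff_mpoly (fun m : 'X_{1..k} => f (mon R k (expword k m)))).
rewrite fN ?wdeg_expword // raddf_sum /= big1 // => n _.
rewrite mcoeffZ mcoeffX; case: eqP => [nm|_]; last by rewrite mulr0.
by have := bmdeg n; rewrite nm ltnNge Nm.
Qed.

Lemma ygen_eval_bij : bijective ygen_eval.
Proof.
pose g f := projT1 (boolp.cid (ygen_eval_surj f)).
have gK : cancel g ygen_eval by move=> f; rewrite /g; case: boolp.cid.
by exists g => //; exact: inj_can_sym gK ygen_eval_inj.
Qed.

End DualMonomials.

Theorem theorem1 (k : nat) (hk : (1 <= k)%N) :
  exists phi : {lrmorphism {mpoly 'F_2[k]} -> gdual 'F_2 k},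
    (forall i : 'I_k, phi 'X_i = ygen 'F_2 k i.+1) /\ bijective phi.
Proof.
exists (ygen_eval 'F_2 k).
by split; [exact: ygen_evalX | exact: ygen_eval_bij].
Qed.
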